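(* Suppose that $\kappa$ is a strongly inaccessible cardinal and that $X$ is a locally $<\kappa$ Hausdorff $D$-space of size $\kappa$. Then for every $\theta<\kappa$ and every subspace $Z$ of $X$ with $|Z|<\kappa$, there is an open subspace $Y$ of $X$ with $\theta<|Y|<\kappa$ which is a $D$-space and which contains $Z$ as a subspace.
   Context: An open neighbourhood assignment (ONA) in a topological space $(X,\tau)$ is a function $U:X\to\tau$ such that $x\in U(x)$ for all $x\in X$. $X$ is a $D$-space iff for every ONA $U$ of $X$ there is a closed discrete $D\subseteq X$ with $\bigcup\{U(x):x\in D\}=X$. $X$ is locally $<\kappa$ iff there is an ONA $U$ of $X$ with $|U(x)|<\kappa$ for all $x\in X$. *)

(* Defs.v *)
From mathcomp Require Import all_boot all_order.
From mathcomp Require Import all_classical.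
From mathcomp Require Import topology.

Set Implicit Arguments.
Unset Strict Implicit.
Unset Printing Implicit Defensive.

Local Open Scope classical_set_scope.
Local Open Scope card_scope.

(* Cardinals are represented by types and sets, compared through injections:
   a type K stands for the cardinal of [set: K]. *)
Definition card_lt (T U : Type) (A : set T) (B : set U) : bool :=
  (A #<= B) && ~~ (B #<= A).

(* K is infinite and not covered by fewer than |K| sets of size less than |K|. It is enough
   to index by subsets of K, since they realize all the cardinals up to |K|. *)
Definition regular_cardinal (K : Type) : Prop :=
  infinite_set [set: K] /\
  forall (I : set K) (F : K -> set K),
    card_lt I [set: K] -> (forall i, I i -> card_lt (F i) [set: K]) ->
    card_lt (\bigcup_(i in I) F i) [set: K].

Definition strong_limit_cardinal (K : Type) : Prop :=
  forall A : set K, card_lt A [set: K] ->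
    card_lt [set B : set K | B `<=` A] [set: K].

Definition strongly_inaccessible (K : Type) : Prop :=
  [/\ ~ countable [set: K], regular_cardinal K & strong_limit_cardinal K].

Definition open_nbhd_assignment (X : topologicalType) (U : X -> set X) : Prop :=
  forall x, open (U x) /\ U x x.

(* For a subset Y of X use D_space (set_type Y), where set_type Y carries the
   subspace topology; the library's subspace Y has carrier X and isolates the
   points outside Y. *)
Definition D_space (X : topologicalType) : Prop :=
  forall U : X -> set X, open_nbhd_assignment U ->
    exists D : set X,
      [/\ closed D, isolated D = D & \bigcup_(x in D) U x = [set: X]].

Definition locally_lt (K : Type) (X : topologicalType) : Prop :=
  exists U : X -> set X,
    open_nbhd_assignment U /\ forall x, card_lt (U x) [set: K].

(* Main.v *)
(** In a Hausdorff space a point [x] of [closure A] is determined by the traces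
    on [A] of its neighbourhoods, so that [|closure A| <= 2^(2^|A|)], which stays
    below a strong limit [kappa].  Starting from the closure [C 0] of a small set
    containing [Z] and more than [theta] points, and putting
    [C n.+1 = closure (\bigcup_(x in C n) U x)] where [U] witnesses local
    smallness, the union [Y] of the [C n] is open, and it is small because
    [kappa] is regular and uncountable.  Finally [Y] is a D-space since it is an
    F_sigma: given neighbourhoods [W x] of its points, choose successively closed
    discrete sets [D n] whose neighbourhoods cover the part of [C n] not covered
    before; the family [D n] is locally finite in [Y]. *)
Require Import Defs.
From mathcomp Require Import all_boot all_order.
From mathcomp Require Import all_classical.
From mathcomp Require Import topology.

Set Implicit Arguments.
Unset Strict Implicit.

Local Open Scope classical_set_scope.
Local Open Scope card_scope.

Lemma card_lt_le_trans (T U V : Type) (A : set T) (B : set U) (C : set V) :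
  card_lt A B -> B #<= C -> card_lt A C.
Proof.
case/andP=> AB nBA BC; apply/andP; split; first exact: card_le_trans AB BC.
by apply: contra nBA; exact: card_le_trans.
Qed.

Lemma card_le_lt_trans (T U V : Type) (A : set T) (B : set U) (C : set V) :
  A #<= B -> card_lt B C -> card_lt A C.
Proof.
move=> AB /andP[BC nCB]; apply/andP; split; first exact: card_le_trans AB BC.
by apply: contra nCB => CA; exact: card_le_trans CA AB.
Qed.

Lemma set_inj_card_le (T U : Type) (A : set T) (B : set U) (f : T -> U) :
  set_fun A B f -> set_inj A f -> A #<= B.
Proof.
move=> fAB fI; have /injfunPex[g] :
    exists2 f : T -> U, set_fun A B f & set_inj A f.
  by exists f.
exact: inj_card_le g.
Qed.

(** [u] is the value taken off [A], where the injection between subtypes says nothing. *)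
Lemma card_le_set_inj (T U : Type) (u : U) (A : set T) (B : set U) :
  A #<= B -> exists2 f : T -> U, set_fun A B f & set_inj A f.
Proof.
move=> /card_leP[g].
pose f t := if pselect (A t) is left At then val (g (SigSub (mem_set At))) else u.
have fE t (At : A t) : f t = val (g (SigSub (mem_set At))).
  rewrite /f; case: pselect => // At'.
  by congr (val (g (SigSub _))); exact: Prop_irrelevance.
exists f => [t At|s t /set_mem As /set_mem At].
  by rewrite /= (fE _ At); exact: set_valP.
rewrite (fE _ As) (fE _ At) => /val_inj /(@inj _ _ _ g).
by move=> /(_ (in_setT _) (in_setT _)) [].
Qed.

Lemma card_lt_powerset (T : Type) (A : set T) :
  card_lt A [set B : set T | B `<=` A].
Proof.
apply/andP; split.
  apply: (set_inj_card_le (f := set1)) => [a Aa b -> //|a b _ _ /= ab].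
  by have : [set b] a by rewrite -ab.
apply/negP => leA.
have [A0|[a _]] : A = set0 \/ A !=set0.
  by have [->|/set0P] := eqVneq A set0; [left|right].
  move: leA; rewrite A0 card_le0 => /eqP P0.
  by have : [set B : set T | B `<=` set0] set0 by []; rewrite P0.
have [f fA fI] := card_le_set_inj a leA.
(* Cantor's diagonal set, for an injection [f] of the power set into [A]. *)
pose D := [set f B | B in [set B | B `<=` A /\ ~ B (f B)]].
have DA : D `<=` A by move=> _ [B [BA _] <-]; exact: fA.
have nD : ~ D (f D).
  move=> DfD; have [B [BA nB] fBD] := DfD.
  have BD : B = D by apply: fI => //; rewrite inE.
  by apply: nB; rewrite BD.
by apply: (nD); exists D => //; split.
Qed.

(** Frees the strong limit property from subsets of [K]: an injection of [A] into [K] induces one on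
    power sets by direct images. *)
Lemma powerset_card_lt (K T : Type) (A : set T) :
  [set: K] !=set0 -> strong_limit_cardinal K -> card_lt A [set: K] ->
  card_lt [set B : set T | B `<=` A] [set: K].
Proof.
move=> [k _] slK ltA; have [f _ fI] := card_le_set_inj k (proj1 (andP ltA)).
have /slK : card_lt (f @` A) [set: K].
  by apply: card_le_lt_trans ltA; exact: card_image_le.
apply: card_le_lt_trans.
apply: (set_inj_card_le (f := image^~ f)) => [B BA _ [x Bx <-]|B C].
  by exists x => //; exact: BA.
rewrite !inE => BA CA; suff sub D E : D `<=` A -> E `<=` A ->
    f @` D = f @` E -> D `<=` E.
  by move=> /= e; apply/seteqP; split; apply: sub.
move=> DA EA e x Dx; have [y Ey fyx] : (f @` E) (f x) by rewrite -e; exists x.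
by rewrite -(fI y x) ?inE //; [exact: EA|exact: DA].
Qed.

Lemma bigcup_card_lt (K T X : Type) (I : set T) (F : T -> set X) :
  regular_cardinal K -> [set: X] #<= [set: K] -> card_lt I [set: K] ->
  (forall i, I i -> card_lt (F i) [set: K]) ->
  card_lt (\bigcup_(i in I) F i) [set: K].
Proof.
move=> [infK regK] leX ltI ltF; have [k _] := infinite_setN0 infK.
have [h _ hI] := card_le_set_inj k leX.
have [g _ gI] := card_le_set_inj k (proj1 (andP ltI)).
(* Regularity speaks of families inside [K], so indices move along [g] and members along [h]; as [g]
   is injective on [I], each union has at most one member. *)
pose G j := \bigcup_(i in [set i | I i /\ g i = j]) (h @` F i).
have GE i : I i -> G (g i) = h @` F i.
  move=> Ii; apply/seteqP; split=> [y [i' [Ii' gi]]|y Fy]; last by exists i.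
  by rewrite (gI i' i) ?inE.
have : card_lt (\bigcup_(j in g @` I) G j) [set: K].
  apply: regK => [|_ [i Ii <-]].
    by apply: card_le_lt_trans ltI; exact: card_image_le.
  by rewrite GE //; apply: card_le_lt_trans (ltF _ Ii); exact: card_image_le.
apply: card_le_lt_trans; apply: (set_inj_card_le (f := h)) => [x [i Ii Fx]|].
  by exists (g i); [exists i|rewrite GE //; exists x].
by move=> x y _ _; apply: hI; rewrite inE.
Qed.

Lemma closure_card_le (X : topologicalType) (A : set X) : hausdorff_space X ->
  closure A #<= [set S : set (set X) | S `<=` [set B | B `<=` A]].
Proof.
move=> hX; pose tr (x : X) : set (set X) := [set V `&` A | V in nbhs x].
apply: (set_inj_card_le (f := tr)) => [x _ _ [V _ <-] z []//|x y].
rewrite !inE => clx cly trxy; apply: hX => V W xV yW.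
(* Equal traces give a neighbourhood [V'] of [y] meeting [A] exactly where [V] does; a point of [A]
   in [W] and [V'] then lies in [V] and [W]. *)
have [V' yV' VV'] : tr y (V `&` A) by rewrite -trxy; exists V.
have [z [Az [Wz V'z]]] := cly _ (filterI yW yV').
have [Vz _] : (V `&` A) z by rewrite -VV'.
by exists z.
Qed.

(** A local form of closed and discrete, tested at all points of [X]; it passes easily to subsets,
    finite unions and subspaces. *)
Definition closed_discrete (X : topologicalType) (D : set X) :=
  forall x, \forall z \near x, D z -> z = x.

Lemma closed_discreteP (X : topologicalType) (D : set X) :
  closed_discrete D <-> closed D /\ isolated D = D.
Proof.
split=> [cdD|[cD iD] x].
  split=> [x clx|]; first by have [z [Dz /(_ Dz) <-]] := clx _ (cdD x).
  apply/seteqP; split=> [|x Dx]; first exact: isolatedS.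
  split; first exact: mem_set.
  exists [set z | D z -> z = x]; first exact: cdD.
  by apply/seteqP; split=> [z [/= zx /zx]//|z ->].
have [Dx|nDx] := pselect (D x).
  have [_ [V xV VD]] : isolated D x by rewrite iD.
  by apply: filterS xV => z Vz Dz; have : (V `&` D) z by []; rewrite VD.
have : nbhs x (~` D) by apply: open_nbhs_nbhs; split => //; exact: closed_openC.
by apply: filterS => z nDz /nDz.
Qed.

(** Points off [F] are assigned the complement of [F], so only the chosen points in [F] can help to
    cover [F]. *)
Lemma D_space_closed (X : topologicalType) (F : set X) (V : X -> set X) :
  D_space X -> closed F -> (forall x, F x -> open (V x) /\ V x x) ->
  exists D, [/\ D `<=` F, closed_discrete D & F `<=` \bigcup_(x in D) V x].
Proof.
move=> DX cF oV; pose V' x := if pselect (F x) then V x else ~` F.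
have [x|D [cD iD DV]] := DX V'.
  rewrite /V'; case: pselect => [/oV//|nFx]; split=> //; exact: closed_openC.
exists (D `&` F); split=> [x []//|x|x Fx].
  have /closed_discreteP/(_ x) : closed D /\ isolated D = D by [].
  by apply: filterS => z Dz [/Dz].
have : [set: X] x by []; rewrite -DV => -[y Dy].
by rewrite /V'; case: pselect => // Fy Vyx; exists y.
Qed.

Lemma D_space_Fsigma (X : topologicalType) (C : nat -> set X) :
  D_space X -> (forall n, closed (C n)) -> D_space (set_type (\bigcup_n C n)).
Proof.
set Y := \bigcup_n C n => DX cC V oV.
have /choice[O OP] : forall y : Y, exists O : set X, open O /\ set_val @^-1` O = V y.
  by move=> y; have [[O oO OV] _] := oV y; exists O.
(* The assignment [O] read on all of [X], with empty value off [Y]. *)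
pose W x := \bigcup_(y in [set y : Y | set_val y = x]) O y.
have WE (y : Y) : W (set_val y) = O y.
  apply/seteqP; split=> [z [y' /val_inj -> //]|z Oz]; by exists y.
have oW x : open (W x) by apply: bigcup_open => y _; case: (OP y).
have WY x : Y x -> W x x.
  move=> Yx; pose y : Y := SigSub (mem_set Yx).
  rewrite -[x]/(set_val y) WE -[_ _]/((set_val @^-1` O y) y).
  by rewrite (OP y).2; case: (oV y).
have /choice[d dP] : forall F : set X, exists D : set X, closed F -> F `<=` Y ->
    [/\ D `<=` F, closed_discrete D & F `<=` \bigcup_(x in D) W x].
  move=> F; have [[cF FY]|nF] := pselect (closed F /\ F `<=` Y); last first.
    by exists set0 => cF FY; case: nF.
  have [x Fx|D DP] := D_space_closed (V := W) DX cF; last by exists D.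
  by split; [exact: oW|apply: WY; exact: FY].
(* [S n] is the open set covered before stage [n], so the part of [C n] left over is closed. *)
pose S := fix S n := if n is m.+1 then
  S m `|` \bigcup_(x in d (C m `\` S m)) W x else set0.
pose D n := d (C n `\` S n).
have SE n : S n.+1 = S n `|` \bigcup_(x in D n) W x by [].
have oS n : open (S n).
  elim: n => [|n IH]; first exact: open0.
  by rewrite SE; apply: openU => //; exact: bigcup_open.
have DP n : [/\ D n `<=` C n `\` S n, closed_discrete (D n) &
    C n `\` S n `<=` \bigcup_(x in D n) W x].
  apply: dP => [|x [Cx _]]; last by exists n.
  by rewrite setDE; apply: closedI => //; exact: open_closedC.
have leS m n : (m <= n)%N -> S m `<=` S n.
  move=> /subnK <-; elim: (n - m)%N => // k IH.
  by rewrite addSn SE; apply: subset_trans IH _; exact: subsetUl.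
have CS n : C n `<=` S n.+1.
  move=> x Cx; rewrite SE; have [|nS] := pselect (S n x); first by left.
  by right; have [_ _] := DP n; apply.
have SD n x : S n x -> exists m, (\bigcup_(x in D m) W x) x.
  by elim: n => // n IH; rewrite SE => -[/IH//|]; exists n.
have nearD n (x : X) : \forall z \near x, forall m, (m < n)%N -> D m z -> z = x.
  elim: n => [|n IH]; first exact: nearW.
  have [_ /(_ x) cd _] := DP n; apply: filterS2 cd IH => z Dz IHz m.
  by rewrite ltnS leq_eqVlt => /orP[/eqP -> //|/IHz].
pose DY : set Y := set_val @^-1` (\bigcup_n D n).
have /closed_discreteP[cDY iDY] : closed_discrete DY.
  move=> y; have [n _ Cy] : Y (set_val y) by exact: set_valP.
  (* Local finiteness: [D m] avoids [S m], which contains [S n.+1] for [m > n], so only [D 0], ...,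
     [D n] matter near [y]. *)
  have Sy : \forall z \near set_val y, S n.+1 z.
    by apply: open_nbhs_nbhs; split=> //; exact: CS.
  have Dy : \forall z \near set_val y, (\bigcup_n D n) z -> z = set_val y.
    apply: filterS2 Sy (nearD n.+1 _) => z Sz Dz [m _ Dmz].
    have [|nm] := ltnP m n.+1; first by move=> /Dz; apply.
    have [/(_ _ Dmz)[_ nSz] _ _] := DP m.
    by case: nSz; exact: leS Sz.
  have cval : continuous (set_val : Y -> X) by exact: initial_continuous.
  have : \forall z \near y, (\bigcup_n D n) (set_val z) -> set_val z = set_val y.
    exact: cval Dy.
  by apply: filterS => z Dz /Dz /val_inj.
exists DY; split=> //; apply/seteqP; split=> // y _.
have [n _ /CS/SD[m [x Dx Wx]]] : Y (set_val y) by exact: set_valP.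
have Yx : Y x by have [/(_ _ Dx)[Cx _] _ _] := DP m; exists m.
exists (SigSub (mem_set Yx)); first by exists m.
by rewrite -(OP _).2 /= -WE.
Qed.

Unset Implicit Arguments.
Set Strict Implicit.

Theorem theorem3p3 (kappa : Type) (X : topologicalType) :
  strongly_inaccessible kappa ->
  locally_lt kappa X ->
  hausdorff_space X ->
  D_space X ->
  [set: X] #= [set: kappa] ->
  forall (theta : Type) (Z : set X),
    card_lt [set: theta] [set: kappa] ->
    card_lt Z [set: kappa] ->
    exists Y : set X,
      [/\ open Y,
          card_lt [set: theta] Y /\ card_lt Y [set: kappa],
          D_space (set_type Y)
        & Z `<=` Y].
Proof.
move=> [ncK regK slK] [U [oU ltU]] hX DX eqXK theta Z lt_theta ltZ.
have infK := regK.1; have K0 := infinite_setN0 infK.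
have [leXK leKX] := (card_eqPle _ _).1 eqXK.
(* Uncountability lets regularity bound unions indexed by [nat]. *)
have lt_nat : card_lt [set: nat] [set: kappa].
  apply/andP; split; [exact/infiniteP|exact/negP].
have lt_bigcup := fun T I F => @bigcup_card_lt kappa T X I F regK leXK.
(* [T] is a copy in [X] of the power set of [theta], which fits since [X] has size [kappa]. *)
have [T lt_thetaT ltT] :
    exists2 T : set X, card_lt [set: theta] T & card_lt T [set: kappa].
  have /andP[leP _] := powerset_card_lt K0 slK lt_theta.
  have /card_subP[T eqT _] := card_le_trans leP leKX.
  have [leTP lePT] := (card_eqPle _ _).1 eqT.
  exists T; first exact: card_lt_le_trans (card_lt_powerset _) lePT.
  by apply: card_le_lt_trans leTP _; exact: powerset_card_lt.
have lt_closure (A : set X) : card_lt A [set: kappa] -> card_lt (closure A) [set: kappa].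
  move=> ltA; apply: card_le_lt_trans (closure_card_le _ hX) _.
  by do 2 apply: powerset_card_lt => //.
have ltZT : card_lt (Z `|` T) [set: kappa].
  rewrite -bigcup2E; apply: lt_bigcup => // -[|[|n]] _ //=.
  by apply: card_le_lt_trans lt_nat; exact: card_ge0.
pose C := fix C n := if n is m.+1 then closure (\bigcup_(x in C m) U x)
  else closure (Z `|` T).
have ltC n : card_lt (C n) [set: kappa].
  by elim: n => [|n IH]; apply: lt_closure => //; exact: lt_bigcup.
have ZTY : Z `|` T `<=` \bigcup_n C n.
  by move=> x ZTx; exists 0%N => //; exact: subset_closure.
exists (\bigcup_n C n); split.
(* The closures add nothing in the limit: each [C n] lies in the union of its [U x], which lies in
   [C n.+1]. *)
- rewrite (_ : \bigcup_n C n = \bigcup_n \bigcup_(x in C n) U x).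
    by apply: bigcup_open => n _; apply: bigcup_open => x _; case: (oU x).
  apply/seteqP; split=> [x [n _ Cx]|x [n _ Ux]].
    by exists n => //; exists x => //; case: (oU x).
  by exists n.+1 => //; exact: subset_closure.
- split; last exact: lt_bigcup.
  apply: card_lt_le_trans lt_thetaT _; apply: subset_card_le.
  by move=> x Tx; apply: ZTY; right.
- by apply: D_space_Fsigma => // -[|n]; exact: closed_closure.
- by move=> x Zx; apply: ZTY; left.
Qed.
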